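(* Let $A,\mathcal{P}\in\mathbb{R}^{n_u\times n_u}$ be symmetric positive definite, let $\mathcal{H},\mathcal{Y}_0\in\mathbb{R}^{n_u\times 3}$, let $\mathcal{Y}^*\in\mathbb{R}^{n_u\times 3}$ be the exact solution of $A\mathcal{P}^{-1}\mathcal{Y}^*=\mathcal{H}$, let $R_0=\mathcal{H}-A\mathcal{P}^{-1}\mathcal{Y}_0$, and let $k\ge 1$. Let $\mathcal{Y}_k$ be the $k$-th iterate of the preconditioned global conjugate gradient method ($\mathcal{P}$GCG), with error $\mathcal{E}_k=\mathcal{Y}^*-\mathcal{Y}_k$ and residual $R_k=A\mathcal{P}^{-1}\mathcal{E}_k$. Let $K_{k+1}=[R_0,(A\mathcal{P}^{-1})R_0,\dots,(A\mathcal{P}^{-1})^kR_0]$ and assume that $K_{k+1}^T\diamond A^{-1}K_{k+1}$ is nonsingular. Let $A=LL^T$ be the Cholesky decomposition of $A$, and let $L^{-1}(A\mathcal{P}^{-1})L=\mathcal{V}\Lambda\mathcal{V}^T$ be a spectral decomposition of this symmetric matrix, with $\mathcal{V}$ orthogonal and $\Lambda=\mathrm{diag}(\lambda_1,\dots,\lambda_{n_u})$. Let the initial residual be decomposed as $R_0=L\mathcal{V}\gamma$ with $\gamma=[\gamma^{(1)},\gamma^{(2)},\gamma^{(3)}]\in\mathbb{R}^{n_u\times 3}$, where the column $\gamma^{(j)}$ has components $\gamma^{(j)}_1,\dots,\gamma^{(j)}_{n_u}$. Set $$\widetilde D=\mathrm{diag}\left(\sum_{j=1}^3|\gamma_1^{(j)}|^2,\dots,\sum_{j=1}^3|\gamma_{n_u}^{(j)}|^2\right),\qquad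 V_{k+1}=\begin{pmatrix}1&\lambda_1&\cdots&\lambda_1^k\\ \vdots&\vdots&&\vdots\\ 1&\lambda_{n_u}&\cdots&\lambda_{n_u}^k\end{pmatrix},$$ and let $e_1$ be the first unit vector of $\mathbb{R}^{k+1}$. Then $$(1)\qquad \|\mathcal{E}_k\|_{\mathcal{P}^{-1}A\mathcal{P}^{-1}}^2=\frac{1}{e_1^T\left(V_{k+1}^T\widetilde DV_{k+1}\right)^{-1}e_1},$$ $$(2)\qquad \|R_k\|_{\mathcal{P}^{-1}}^2\le\frac{1}{e_1^T\left(V_{k+1}^T\widetilde DV_{k+1}\right)^{-1}e_1}\left(\frac{\tilde\theta^{\,k+1}}{\theta^{\,k}}\right),$$ where $\tilde\theta$ is the maximum eigenvalue of $\hat T_{k+1}$ and $\theta$ is the minimum eigenvalue of $T_k$. Here $T_k$ and $\hat T_{k+1}$ are the tridiagonal matrices obtained by the Lanczos process, $$T_k=U_k^T\diamond\mathcal{P}^{-1}A\mathcal{P}^{-1}U_k=\begin{bmatrix}\alpha_1&\eta_2&&&\\ \eta_2&\alpha_2&\eta_3&&\\ &\ddots&\ddots&\ddots&\\ &&\eta_{k-1}&\alpha_{k-1}&\eta_k\\ &&&\eta_k&\alpha_k\end{bmatrix},$$ $$\hat T_{k+1}=\left(U_{k+1}^T\diamond A^{-1}U_{k+1}\right)^{-1}=\begin{bmatrix}\alpha_1&\eta_2&&&\\ \eta_2&\alpha_2&\eta_3&&\\ &\ddots&\ddots&\ddots&\\ &&\eta_k&\alpha_k&\eta_{k+1}\\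 &&&\eta_{k+1}&\hat\eta_{k+1}\end{bmatrix}$$ for some real numbers $\alpha_i,\eta_i,\hat\eta_{k+1}$.
   Context: Frobenius inner product: $\langle \mathcal{X},\mathcal{Z}\rangle_F=\mathrm{Trace}(\mathcal{X}^T\mathcal{Z})$ for $\mathcal{X},\mathcal{Z}\in\mathbb{R}^{n_u\times 3}$. For a symmetric positive definite $M\in\mathbb{R}^{n_u\times n_u}$, $\langle\mathcal{X},\mathcal{Z}\rangle_M=\mathrm{Trace}(\mathcal{Z}^TM\mathcal{X})$ and $\|\mathcal{X}\|_M=\sqrt{\mathrm{Trace}(\mathcal{X}^TM\mathcal{X})}$; this is used with $M=\mathcal{P}^{-1}$ and $M=\mathcal{P}^{-1}A\mathcal{P}^{-1}$. Diamond product: if $Y=[Y_1,\dots,Y_s]\in\mathbb{R}^{n_u\times 3s}$ and $Z=[Z_1,\dots,Z_r]\in\mathbb{R}^{n_u\times 3r}$ are concatenations of blocks $Y_i,Z_j\in\mathbb{R}^{n_u\times 3}$, then $Y^T\diamond Z\in\mathbb{R}^{s\times r}$ is the matrix with $(i,j)$ entry $\langle Y_i,Z_j\rangle_F$. For a matrix $M\in\mathbb{R}^{n_u\times n_u}$, $Y^T\diamond MZ$ means $Y^T\diamond(MZ)$, where $MZ=[MZ_1,\dots,MZ_r]$. Global Krylov subspace: $\mathcal{K}_k(A\mathcal{P}^{-1},R_0)=\left\{\sum_{i=1}^k\psi_i(A\mathcal{P}^{-1})^{i-1}R_0:\psi_1,\dots,\psi_k\in\mathbb{R}\right\}\subset\mathbb{R}^{n_u\times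 3}$. $\mathcal{P}$GCG iterate: $\mathcal{Y}_k$ is characterized by the two relations $$\mathcal{Y}_k-\mathcal{Y}_0\in\mathcal{K}_k(A\mathcal{P}^{-1},R_0),\qquad \langle R_k,\mathcal{Z}\rangle_{\mathcal{P}^{-1}}=0\ \text{ for all }\mathcal{Z}\in\mathcal{K}_k(A\mathcal{P}^{-1},R_0),$$ where $R_k=\mathcal{H}-A\mathcal{P}^{-1}\mathcal{Y}_k=A\mathcal{P}^{-1}\mathcal{E}_k$. The method solves the multiple right-hand side system $A\mathcal{X}=\mathcal{H}$ with preconditioner $\mathcal{P}=GG^T$, where $G$ is a nonsingular lower triangular matrix. Lanczos basis: for $m=k$ and $m=k+1$, $U_m=[u_1,\dots,u_m]\in\mathbb{R}^{n_u\times 3m}$ consists of the first $m$ blocks of one sequence $u_1,\dots,u_{k+1}\in\mathbb{R}^{n_u\times 3}$ such that $u_1,\dots,u_i$ is a basis of $\mathcal{K}_i(A\mathcal{P}^{-1},R_0)$ for every $1\le i\le k+1$, and $U_m^T\diamond\mathcal{P}^{-1}U_m=I_m$ (the basis is orthonormal for $\langle\cdot,\cdot\rangle_{\mathcal{P}^{-1}}$). *)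

(* Defs.v *)
From HB Require Import structures.
From mathcomp Require Import all_boot all_order all_algebra.
From mathcomp Require Import reals.

Set Implicit Arguments.
Unset Strict Implicit.
Unset Printing Implicit Defensive.

Import Order.TTheory GRing.Theory Num.Theory.
Local Open Scope ring_scope.

Definition spd (R : realType) (n : nat) (M : 'M[R]_n) : Prop :=
  M^T = M /\ forall x : 'cV[R]_n, x != 0 -> 0 < (x^T *m M *m x) 0 0.

Definition frob (R : realType) (n p : nat) (X Z : 'M[R]_(n, p)) : R :=
  \tr (X^T *m Z).

Definition innerM (R : realType) (n p : nat) (M : 'M[R]_n)
  (X Z : 'M[R]_(n, p)) : R := \tr (Z^T *m M *m X).

Definition normM (R : realType) (n p : nat) (M : 'M[R]_n)
  (X : 'M[R]_(n, p)) : R := Num.sqrt (\tr (X^T *m M *m X)).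

(* [diamond Y Z] is the matrix Y^T <> Z: the transposition of the first
   argument is part of the definition.  A matrix [Y_1, ..., Y_s] of s blocks
   of three columns has type 'M_(n, \sum_(i < s) 3) and is built by \mxrow. *)
Definition diamond (R : realType) (n s r : nat)
  (Y : 'M[R]_(n, \sum_(i < s) 3)) (Z : 'M[R]_(n, \sum_(j < r) 3))
  : 'M[R]_(s, r) :=
  \matrix_(i < s, j < r) frob (submxrow Y i) (submxrow Z j).

Definition krylov (R : realType) (n : nat) (k : nat) (M : 'M[R]_n)
  (R0 : 'M[R]_(n, 3)) : {vspace 'M[R]_(n, 3)} :=
  <<[tuple M ^+ i *m R0 | i < k]>>%VS.

Lemma krylovP (R : realType) (n k : nat) (M : 'M[R]_n)
  (R0 X : 'M[R]_(n, 3)) :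
  X \in krylov k M R0 <->
  exists psi : 'I_k -> R, X = \sum_(i < k) psi i *: (M ^+ i *m R0).
Proof.
split=> [/coord_span ->|[psi ->]].
  by eexists; apply: eq_bigr => i _; rewrite (nth_mktuple _ 0 i).
apply: rpred_sum => i _; apply: rpredZ; apply: memv_span.
by apply/tnthP; exists i; rewrite tnth_mktuple.
Qed.

Definition krylov_matrix (R : realType) (n m : nat) (M : 'M[R]_n)
  (R0 : 'M[R]_(n, 3)) : 'M[R]_(n, \sum_(i < m) 3) :=
  \mxrow_(i < m) (M ^+ i *m R0).

Definition pgcg_iterate (R : realType) (n : nat) (A P : 'M[R]_n)
  (H Y0 : 'M[R]_(n, 3)) (k : nat) (Yk : 'M[R]_(n, 3)) : Prop :=
  let M := A *m invmx P in
  let R0 := H - M *m Y0 in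
  let Rk := H - M *m Yk in
  Yk - Y0 \in krylov k M R0 /\
  forall Z : 'M[R]_(n, 3), Z \in krylov k M R0 -> innerM (invmx P) Rk Z = 0.

(* The block u_(i+1) of the mathematical text is [u i]. *)
Definition lanczos_block (R : realType) (n : nat) (u : nat -> 'M[R]_(n, 3))
  (m : nat) : 'M[R]_(n, \sum_(i < m) 3) := \mxrow_(i < m) u i.

Definition lanczos_basis (R : realType) (n : nat) (A P : 'M[R]_n)
  (R0 : 'M[R]_(n, 3)) (k : nat) (u : nat -> 'M[R]_(n, 3)) : Prop :=
  (forall i : nat, (1 <= i <= k.+1)%N ->
     basis_of (krylov i (A *m invmx P) R0) (mkseq u i)) /\
  (forall m : nat, m = k \/ m = k.+1 ->
     diamond (lanczos_block u m) (invmx P *m lanczos_block u m) = 1%:M).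

Definition cholesky (R : realType) (n : nat) (A L : 'M[R]_n) : Prop :=
  [/\ is_trig_mx L, forall i : 'I_n, 0 < L i i & A = L *m L^T].

Definition max_eigenvalue (R : realType) (n : nat) (M : 'M[R]_n) (t : R)
  : Prop := eigenvalue M t /\ forall a : R, eigenvalue M a -> a <= t.

Definition min_eigenvalue (R : realType) (n : nat) (M : 'M[R]_n) (t : R)
  : Prop := eigenvalue M t /\ forall a : R, eigenvalue M a -> t <= a.

(* Diagonal entries d 1, ..., d m; the off-diagonal entries in positions
   (i, i+1) and (i+1, i), counted from 1, are e (i+1), so that e 1 is unused. *)
Definition tridiag (R : realType) (m : nat) (d e : nat -> R) : 'M[R]_m :=
  \matrix_(i < m, j < m)
    if i == j then d i.+1
    else if j == i.+1 :> nat then e j.+1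
    else if i == j.+1 :> nat then e i.+1
    else 0.

(* Main.v *)
(* Write B = P^-1 and M = A B.  The matrix W is the Gram matrix of the M^i R0
   for <.,.>_(A^-1).  Since R_k is a combination of the M^i R0 with coefficient
   1 at i = 0, and is A^-1-orthogonal to the M^i R0 with 1 <= i <= k, its
   coordinates c satisfy W c = ||R_k||^2_(A^-1) e_1, which gives (1).

   For (2), R_k is B-orthogonal to K_k, so R_k = r u_(k+1) and
   ||R_k||^2_(A^-1) = r^2 S_(k+1,k+1) with S = That^-1.  The last diagonal entry
   of S is at least 1 / thetat.  As T is the leading block of That,
   0 < theta <= thetat, so the factor (thetat / theta)^k is at least 1. *)
Require Import Defs.
From mathcomp Require Import all_boot all_order all_algebra.
From mathcomp Require Import reals.
From mathcomp Require Import sesquilinear spectral.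
From mathcomp Require Import complex.

Set Implicit Arguments.
Unset Strict Implicit.
Unset Printing Implicit Defensive.

Import Order.TTheory GRing.Theory Num.Theory.
Local Open Scope ring_scope.

(** * Rayleigh quotients of real symmetric matrices *)

(** Over the complex numbers [M] is Hermitian, so a unitary [U] diagonalizes it with real
    eigenvalues [d]. In the coordinates [y = U x] the two forms are the sums of [d_i |y_i|^2] and of
    [|y_i|^2]. *)
Lemma symmetric_rayleigh_le (R : rcfType) (n : nat) (M : 'M[R]_n) (t : R) :
  M^T = M -> (forall a : R, eigenvalue M a -> a <= t) ->
  forall x : 'cV[R]_n, (x^T *m M *m x) 0 0 <= t * (x^T *m x) 0 0.
Proof.
move=> Msym Mt x.
pose toC : {rmorphism R -> complex R} := real_complex R.
pose Mc := map_mx toC M.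
have toC_real a : toC a \is Num.real by apply/complex_realP; exists a.
have Mherm : Mc \is hermsymmx.
  apply: realsym_hermsym; last by apply/mxOverP => i j; rewrite mxE.
  apply/is_hermitianmxP; rewrite expr0 scale1r.
  by apply/matrixP => i j; rewrite !mxE -{1}Msym mxE.
have /hermitian_normalmx/orthomx_spectralP := Mherm.
have /mxOverP dreal := hermitian_spectral_diag_real Mherm.
move: (spectral_unitarymx Mc) dreal.
set U := spectralmx Mc; set d := spectral_diag Mc => Uunit dreal Mdec.
have UM : U *m Mc = diag_mx d *m U.
  by rewrite Mdec !mulmxA mulmxV ?mul1mx // unitarymx_unit.
(* Row [i] of [U] is a left eigenvector for [d 0 i], which is real and hence already an eigenvalue
   of [M]. *)
have dle i : d 0 i <= toC t.
  have /complex_realP[a da] := dreal 0 i.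
  rewrite da lecR; apply: Mt.
  rewrite -(eigenvalue_map toC) /= -[toC a]da -/Mc.
  apply/eigenvalueP; exists (row i U).
    by rewrite -row_mul UM mul_diag_mx; apply/rowP => j; rewrite !mxE.
  apply/eqP; rewrite rowE => /(canRL (mulmxK (unitarymx_unit Uunit))).
  by rewrite mul0mx => /matrixP/(_ 0 i)/eqP; rewrite !mxE !eqxx oner_eq0.
pose xc := map_mx toC x; pose y := U *m xc.
have ycE : (map_mx Num.conj y)^T = xc^T *m invmx U.
  rewrite invmx_unitary // /y map_mxM trmx_mul -map_trmx. congr (_ *m _).
  by congr trmx; apply: realmxC; apply/mxOverP => i j; rewrite mxE.
have MxE : toC ((x^T *m M *m x) 0 0) = \sum_i d 0 i * `|y i 0| ^+ 2.
  have -> : toC ((x^T *m M *m x) 0 0) = (xc^T *m Mc *m xc) 0 0.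
    by rewrite [xc^T]map_trmx -!map_mxM [RHS]mxE.
  rewrite Mdec !mulmxA -ycE -mulmxA -/y mxE. apply: eq_bigr => i _.
  by rewrite mul_mx_diag !mxE normCK [LHS]mulrC [RHS]mulrCA [X in _ * X]mulrC.
have xxE : toC ((x^T *m x) 0 0) = \sum_i `|y i 0| ^+ 2.
  have -> : toC ((x^T *m x) 0 0) = (xc^T *m xc) 0 0.
    by rewrite [xc^T]map_trmx -!map_mxM [RHS]mxE.
  rewrite -[xc^T](mulmxKV (unitarymx_unit Uunit)) -ycE -mulmxA -/y mxE.
  by apply: eq_bigr => i _; rewrite !mxE normCK mulrC.
rewrite -lecR; change (toC ((x^T *m M *m x) 0 0) <= toC (t * (x^T *m x) 0 0)).
rewrite rmorphM /= MxE xxE mulr_sumr; apply: ler_sum => i _.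
by apply: ler_wpM2r => //; rewrite exprn_ge0.
Qed.

(** * Positive definite matrices and their inner products on block columns *)

Lemma spd_unitmx (R : realType) (n : nat) (M : 'M[R]_n) :
  spd M -> M \in unitmx.
Proof.
case=> Msym Mpos; rewrite -row_free_unit -kermx_eq0.
apply/rowV0P => v /sub_kermxP vM; apply/eqP; apply: contraT => v0.
have := Mpos v^T; rewrite trmxK vM mul0mx mxE ltxx => -> //.
by apply: contra v0 => /eqP/(congr1 trmx); rewrite trmxK trmx0 => ->.
Qed.

Lemma spd_invmx (R : realType) (n : nat) (M : 'M[R]_n) :
  spd M -> spd (invmx M).
Proof.
move=> hM; have Mu := spd_unitmx hM; case: hM => Msym Mpos.
have iMsym : (invmx M)^T = invmx M by rewrite trmx_inv Msym.
split=> // x x0.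
have -> : x^T *m invmx M *m x = (invmx M *m x)^T *m M *m (invmx M *m x).
  by rewrite trmx_mul iMsym -!mulmxA mulKVmx.
apply: Mpos; apply: contra x0 => /eqP /(congr1 (mulmx M)).
by rewrite mulKVmx // mulmx0 => ->.
Qed.

Lemma innerM_sym (R : realType) (n p : nat) (M : 'M[R]_n) (X Z : 'M[R]_(n, p)) :
  M^T = M -> innerM M X Z = innerM M Z X.
Proof.
by move=> Msym; rewrite /innerM -mxtrace_tr !trmx_mul trmxK Msym mulmxA.
Qed.

Lemma innerM_suml (R : realType) (n p m : nat) (M : 'M[R]_n)
  (c : 'I_m -> R) (F : 'I_m -> 'M[R]_(n, p)) (Z : 'M[R]_(n, p)) :
  innerM M (\sum_i c i *: F i) Z = \sum_i c i * innerM M (F i) Z.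
Proof.
rewrite /innerM mulmx_sumr raddf_sum; apply: eq_bigr => i _ /=.
by rewrite -scalemxAr mxtraceZ.
Qed.

Lemma innerM_sumr (R : realType) (n p m : nat) (M : 'M[R]_n)
  (c : 'I_m -> R) (F : 'I_m -> 'M[R]_(n, p)) (X : 'M[R]_(n, p)) :
  innerM M X (\sum_i c i *: F i) = \sum_i c i * innerM M X (F i).
Proof.
rewrite /innerM linear_sum /= !mulmx_suml raddf_sum; apply: eq_bigr => i _ /=.
by rewrite linearZ /= -!scalemxAl mxtraceZ.
Qed.

Lemma innerM_scale (R : realType) (n p : nat) (M : 'M[R]_n) (a : R)
  (X : 'M[R]_(n, p)) : innerM M (a *: X) (a *: X) = a ^+ 2 * innerM M X X.
Proof.
rewrite /innerM -scalemxAr mxtraceZ [(a *: X)^T]linearZ /= -!scalemxAl mxtraceZ.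
by rewrite mulrA.
Qed.

Lemma innerM_col (R : realType) (n p : nat) (M : 'M[R]_n) (X : 'M[R]_(n, p)) :
  innerM M X X = \sum_j ((col j X)^T *m M *m col j X) 0 0.
Proof.
apply: eq_bigr => j _; rewrite tr_col -row_mul mxE [RHS]mxE.
by apply: eq_bigr => l _; rewrite !mxE.
Qed.

Lemma spd_form_ge0 (R : realType) (n : nat) (M : 'M[R]_n) (x : 'cV[R]_n) :
  spd M -> 0 <= (x^T *m M *m x) 0 0.
Proof.
case=> _ Mpos; have [->|/Mpos/ltW//] := eqVneq x 0.
by rewrite mulmx0 mxE.
Qed.

Lemma spd_innerM_ge0 (R : realType) (n p : nat) (M : 'M[R]_n)
  (X : 'M[R]_(n, p)) : spd M -> 0 <= innerM M X X.
Proof.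
by move=> hM; rewrite innerM_col sumr_ge0 // => j _; apply: spd_form_ge0.
Qed.

Lemma spd_innerM_gt0 (R : realType) (n p : nat) (M : 'M[R]_n)
  (X : 'M[R]_(n, p)) : spd M -> X != 0 -> 0 < innerM M X X.
Proof.
move=> hM; rewrite lt_def spd_innerM_ge0 // andbT.
apply: contra_neq; rewrite innerM_col => XM; apply/matrixP => i j.
suff /colP/(_ i) : col j X = 0 by rewrite !mxE.
apply/eqP; apply: contraT => /(proj2 hM).
by rewrite (psumr_eq0P _ XM) ?ltxx // => l _; apply: spd_form_ge0.
Qed.

(** * Gram matrices *)

(** The arguments are swapped because [innerM] transposes its second one: entry [(i, j)] is the
    trace of [(f i)^T N (f j)], as in the diamond product. *)
Definition gram (R : realType) (n p m : nat) (N : 'M[R]_n)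
  (f : 'I_m -> 'M[R]_(n, p)) : 'M[R]_m :=
  \matrix_(i, j) innerM N (f j) (f i).

Lemma diamond_gram (R : realType) (n m : nat) (N : 'M[R]_n)
  (f : 'I_m -> 'M[R]_(n, 3)) :
  diamond (\mxrow_(i < m) f i) (N *m \mxrow_(i < m) f i) = gram N f.
Proof.
apply/matrixP => i j; rewrite !mxE mul_mxrow.
by rewrite (mxrowK f) (mxrowK (fun j => N *m f j)) /frob /innerM mulmxA.
Qed.

Lemma gram_form (R : realType) (n p m : nat) (N : 'M[R]_n)
  (f : 'I_m -> 'M[R]_(n, p)) (x y : 'cV[R]_m) :
  (y^T *m gram N f *m x) 0 0 =
  innerM N (\sum_j x j 0 *: f j) (\sum_i y i 0 *: f i).
Proof.
rewrite innerM_suml mxE; apply: eq_bigr => j _; rewrite innerM_sumr mulrC mxE.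
by congr (_ * _); apply: eq_bigr => i _; rewrite !mxE.
Qed.

Lemma gram_spd (R : realType) (n p m : nat) (N : 'M[R]_n)
  (f : 'I_m -> 'M[R]_(n, p)) :
  spd N -> (forall c : 'I_m -> R, \sum_i c i *: f i = 0 -> forall i, c i = 0) ->
  spd (gram N f).
Proof.
move=> hN ffree; split=> [|x x0].
  by apply/matrixP => i j; rewrite !mxE innerM_sym // (proj1 hN).
rewrite gram_form; apply: spd_innerM_gt0 => //.
apply: contra x0 => /eqP/ffree xi0.
by apply/eqP/colP => i; rewrite xi0 mxE.
Qed.

(** * Entries of inverses and eigenvalues of leading blocks *)

(** Since [c = rho W^-1 e_1], its first coordinate, normalized to 1, is [rho] times the corner of
    [W^-1]. *)
Lemma invmx_corner (F : fieldType) (m : nat) (W : 'M[F]_m.+1) (c : 'cV[F]_m.+1)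
  (rho : F) :
  W \in unitmx -> W *m c = rho *: delta_mx 0 0 -> c 0 0 = 1 ->
  let e1 : 'cV[F]_m.+1 := delta_mx 0 0 in
  rho * (e1^T *m invmx W *m e1) 0 0 = 1.
Proof.
move=> Wu Wc c0 e1; rewrite -{}c0 -[c in RHS](mulKmx Wu) Wc -scalemxAr [RHS]mxE.
by rewrite -mulmxA trmx_delta -rowE mxE.
Qed.

(* The form of [S] is nonnegative at [t *: e - invmx S *m e], [e] the i-th unit
   vector. *)
Lemma spd_diag_ge (R : realType) (m : nat) (S : 'M[R]_m) (t : R) (i : 'I_m) :
  spd S -> (forall a : R, eigenvalue (invmx S) a -> a <= t) ->
  0 < t /\ 1 <= t * S i i.
Proof.
move=> hS tmax; have Su := spd_unitmx hS; have hS' := spd_invmx hS.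
pose e : 'cV[R]_m := delta_mx i 0.
have eE (N : 'M[R]_m) : (e^T *m N *m e) 0 0 = N i i.
  by rewrite trmx_delta -rowE -colE !mxE.
have eM (N : 'M[R]_m) : e^T *m N *m e = (N i i)%:M.
  by rewrite [LHS]mx11_scalar eE.
have e0 : e != 0.
  by apply/eqP => /matrixP/(_ i 0)/eqP; rewrite !mxE !eqxx oner_eq0.
have Sit : invmx S i i <= t.
  have := symmetric_rayleigh_le (proj1 hS') tmax e; rewrite eE.
  by rewrite -[e^T]mulmx1 eE mxE eqxx mulr1.
have t0 : 0 < t by apply: lt_le_trans Sit; rewrite -eE; apply: (proj2 hS').
split=> //; have := spd_form_ge0 (t *: e - invmx S *m e) hS.
have -> : (t *: e - invmx S *m e)^T *m S *m (t *: e - invmx S *m e) =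
    t ^+ 2 *: (e^T *m S *m e) - (t *+ 2) *: (e^T *m 1%:M *m e)
    + e^T *m invmx S *m e.
  have -> : (t *: e - invmx S *m e)^T = t *: e^T - e^T *m invmx S.
    by rewrite [LHS]linearB /= linearZ /= trmx_mul (proj1 hS').
  rewrite mulmxBl mulmxBr -!scalemxAl mulmxKV // !mulmxBl.
  rewrite -!scalemxAl -!scalemxAr.
  rewrite -!mulmxA mulKVmx // mul1mx mulr2n scalerDl.
  by rewrite scalerA -expr2 opprB opprD !addrA addrAC.
(* The form gives [0 <= t^2 S_ii - 2 t + (S^-1)_ii]; bounding the last term by [t] leaves
   [t <= t^2 S_ii]. *)
rewrite !eM !mxE !eqxx !mulr1n mulr1 => form0.
rewrite -(ler_pM2l t0) mulr1 mulrA -expr2 -subr_ge0.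
apply: le_trans form0 _; rewrite mulr2n opprD addrA -addrA gerDl.
by rewrite addrC subr_le0.
Qed.

(** An eigenvector of [T] padded with a final zero never meets the last row and column of [T'], so
    [a] is a Rayleigh quotient of [T']. *)
Lemma eigenvalue_lift_max (R : realFieldType) (m : nat) (T : 'M[R]_m)
  (T' : 'M[R]_m.+1) (a : R) :
  (forall i j, T' (lift ord_max i) (lift ord_max j) = T i j) ->
  eigenvalue T a ->
  exists2 x : 'cV[R]_m.+1, x != 0 &
    (x^T *m T' *m x) 0 0 = a * (x^T *m x) 0 0.
Proof.
move=> TT' /eigenvalueP[v vT v0].
pose x : 'cV[R]_m.+1 :=
  \col_i if unlift ord_max i is Some j then v 0 j else 0.
have xl j : x (lift ord_max j) 0 = v 0 j by rewrite mxE liftK.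
have xm : x ord_max 0 = 0 by rewrite mxE unlift_none.
exists x.
  apply: contra v0 => /eqP x0; apply/eqP/rowP => j.
  by rewrite -xl x0 !mxE.
have -> : (x^T *m T' *m x) 0 0 = (v *m T *m v^T) 0 0.
  rewrite !mxE (bigD1_ord ord_max) //= xm mulr0 add0r; apply: eq_bigr => j _.
  rewrite xl !mxE (bigD1_ord ord_max) //= mxE xm mul0r add0r.
  by congr (_ * _); apply: eq_bigr => l _; rewrite mxE xl TT'.
rewrite vT -scalemxAl mxE; congr (_ * _).
rewrite !mxE (bigD1_ord ord_max) //= xm mulr0 add0r; apply: eq_bigr => j _.
by rewrite !mxE liftK.
Qed.

(** * Krylov subspaces *)

Lemma mulmx_exprS (R : pzRingType) (n p i : nat) (M : 'M[R]_n)
  (X : 'M[R]_(n, p)) : M ^+ i.+1 *m X = M *m (M ^+ i *m X).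
Proof. by rewrite exprS mulmxA. Qed.

Lemma krylov_mem (R : realType) (n k i : nat) (M : 'M[R]_n)
  (R0 : 'M[R]_(n, 3)) : (i < k)%N -> M ^+ i *m R0 \in krylov k M R0.
Proof.
move=> ik; apply: memv_span; apply/tnthP; exists (Ordinal ik).
by rewrite tnth_mktuple.
Qed.

Lemma krylov_mul (R : realType) (n k : nat) (M : 'M[R]_n)
  (R0 X : 'M[R]_(n, 3)) :
  X \in krylov k M R0 -> M *m X \in krylov k.+1 M R0.
Proof.
move=> /krylovP[psi ->]; rewrite mulmx_sumr; apply: rpred_sum => i _.
by rewrite -scalemxAr -mulmx_exprS; apply/rpredZ/krylov_mem; rewrite ltnS.
Qed.

Lemma krylov_sub (R : realType) (n k m : nat) (M : 'M[R]_n)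
  (R0 X : 'M[R]_(n, 3)) :
  (k <= m)%N -> X \in krylov k M R0 -> X \in krylov m M R0.
Proof.
move=> km /krylovP[psi ->]; apply: rpred_sum => i _; apply: rpredZ.
by apply: krylov_mem; apply: leq_trans km.
Qed.

(** This links the two inner products: [B]-orthogonality to a Krylov space becomes
    [A^-1]-orthogonality to its image under [A B]. *)
Lemma innerM_invmx (R : realType) (n p : nat) (A B : 'M[R]_n)
  (X Z : 'M[R]_(n, p)) : A \in unitmx ->
  innerM (invmx A) (A *m B *m X) Z = innerM B X Z.
Proof. by move=> Au; rewrite /innerM -!mulmxA mulKmx. Qed.

(** * The Lanczos basis and its tridiagonal matrices *)

Section Lanczos.

Variables (R : realType) (n k : nat) (A P : 'M[R]_n) (R0 : 'M[R]_(n, 3)).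
Variable u : nat -> 'M[R]_(n, 3).
Hypotheses (hA : spd A) (hP : spd P) (hu : lanczos_basis A P R0 k u).

Let B := invmx P.
Let M := A *m B.
Let ip (X Z : 'M[R]_(n, 3)) := innerM B X Z.

Lemma lanczos_orthonormal (i j : nat) : (i < k.+1)%N -> (j < k.+1)%N ->
  ip (u j) (u i) = (i == j)%:R.
Proof.
move=> ik jk; have /matrixP := (proj2 hu) k.+1 (or_intror erefl).
rewrite [diamond _ _](diamond_gram _ (fun i : 'I_k.+1 => u i)).
by move=> /(_ (Ordinal ik) (Ordinal jk)); rewrite !mxE.
Qed.

Lemma lanczos_mem (i : nat) : (i < k.+1)%N -> u i \in krylov i.+1 M R0.
Proof.
move=> ik; have /basis_mem := (proj1 hu) i.+1 ik; apply.
by apply/mapP; exists i; rewrite // mem_iota /= add0n.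
Qed.

Lemma lanczos_span (i : nat) (X : 'M[R]_(n, 3)) :
  (i <= k.+1)%N -> X \in krylov i M R0 ->
  exists c : 'I_i -> R, X = \sum_(j < i) c j *: u j.
Proof.
(* The basis hypothesis starts at [i = 1]; for [i = 0] both sums are empty. *)
case: i => [_ /krylovP[psi ->]|i ik XK].
  by exists psi; rewrite !big_ord0.
have := (proj1 hu) i.+1 ik.
rewrite -[mkseq _ _]/(val (Tuple (introT eqP (size_mkseq u i.+1)))).
move=> /coord_basis/(_ XK) ->; eexists; apply: eq_bigr => j _.
by rewrite nth_mkseq.
Qed.

(** With indices from 0, [X] is a combination of [u 0], ..., [u i.-1], all orthogonal to [u l] when
    [i <= l]. *)
Lemma lanczos_orth (i l : nat) (X : 'M[R]_(n, 3)) :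
  (i <= l < k.+1)%N -> X \in krylov i M R0 -> ip X (u l) = 0.
Proof.
case/andP=> il lk /(lanczos_span (leq_trans il (ltnW lk)))[c ->].
rewrite /ip innerM_suml big1 // => j _; have ji := ltn_ord j.
rewrite [innerM _ _ _]lanczos_orthonormal //; last first.
  by apply: leq_trans (leq_trans il (ltnW lk)).
by rewrite gtn_eqF ?mulr0 // (leq_trans ji).
Qed.

Lemma lanczos_expansion (X : 'M[R]_(n, 3)) : X \in krylov k.+1 M R0 ->
  X = \sum_(l < k.+1) ip X (u l) *: u l.
Proof.
move=> /(lanczos_span (leqnn _))[c XE]; rewrite [LHS]XE.
apply: eq_bigr => l _; congr (_ *: _); rewrite XE /ip innerM_suml (bigD1 l) //=.
rewrite [innerM _ _ _]lanczos_orthonormal // eqxx mulr1 big1 ?addr0 // => j jl.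
by rewrite [innerM _ _ _]lanczos_orthonormal // eq_sym [_ == _](negPf jl) mulr0.
Qed.

Lemma lanczos_free (c : 'I_k.+1 -> R) :
  \sum_i c i *: u i = 0 -> forall i, c i = 0.
Proof.
have := basis_free ((proj1 hu) k.+1 (leqnn _)).
rewrite -[mkseq _ _]/(val (Tuple (introT eqP (size_mkseq u k.+1)))).
move=> /freeP ufree c0.
by apply: ufree; rewrite -[RHS]c0; apply: eq_bigr => i _; rewrite nth_mkseq.
Qed.

(** The coordinate of [M u_j] along [u_i]. Indexing by naturals lets the same [t] describe both [T]
    and [That]. *)
Let t (i j : nat) := ip (M *m u j) (u i).

(** [M] is self-adjoint for [ip] because [B M = B A B] is symmetric. *)
Lemma lanczos_tC i j : t i j = t j i.
Proof.
have Asym := proj1 hA; have Bsym := proj1 (spd_invmx hP).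
rewrite /t /ip /innerM -mxtrace_tr !trmx_mul trmxK Asym -/B Bsym.
by rewrite !mulmxA.
Qed.

(** [M u_j] lies in the Krylov space of order [j + 2], to which [u_i] is orthogonal as soon as
    [i >= j + 2]. *)
Lemma lanczos_t0 i j : (j.+1 < i < k.+1)%N -> t i j = 0.
Proof.
case/andP=> ji ik; apply: (@lanczos_orth j.+2); first by rewrite ji.
by apply: krylov_mul; apply: lanczos_mem; apply: ltn_trans ik; apply: ltnW.
Qed.

Lemma lanczos_T :
  diamond (lanczos_block u k) (B *m A *m B *m lanczos_block u k) =
  \matrix_(i < k, j < k) t i j.
Proof.
rewrite [LHS](diamond_gram _ (fun i : 'I_k => u i)).
by apply/matrixP => i j; rewrite !mxE /t /ip /innerM !mulmxA.
Qed.

Let S := gram (invmx A) (fun i : 'I_k.+1 => u i).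

Lemma lanczos_S_spd : spd S.
Proof. by apply: gram_spd => //; [apply: spd_invmx | apply: lanczos_free]. Qed.

(* [M *m u j] lies in the span of the basis for [j < k], so the j-th column of
   coordinates [t _ j] is mapped by [S] to the j-th unit vector. *)
Lemma lanczos_That (i : 'I_k.+1) (j : 'I_k) :
  invmx S i (lift ord_max j) = t i j.
Proof.
have Su := spd_unitmx lanczos_S_spd; have jk : (j < k.+1)%N := leqW (ltn_ord j).
pose c : 'cV[R]_k.+1 := \col_l t l j.
have Sc : S *m c = delta_mx (lift ord_max j) 0.
  apply/colP => l; rewrite !mxE.
  (* Entry [l] of [S c] is the [A^-1]-product of [M u_j] with [u_l], that is, the [B]-product of
     [u_j] with [u_l]. *)
  transitivity (innerM (invmx A) (M *m u j) (u l)).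
    have -> : M *m u j = \sum_(l < k.+1) t l j *: u l.
      apply: lanczos_expansion; apply: (@krylov_sub _ _ j.+2).
        by rewrite ltnS; apply: ltn_ord.
      by apply: krylov_mul; apply: lanczos_mem.
    by rewrite innerM_suml; apply: eq_bigr => m _; rewrite !mxE mulrC.
  rewrite innerM_invmx ?spd_unitmx // [LHS]lanczos_orthonormal //.
  by rewrite andbT -[in LHS](lift_max j).
have := mulKmx Su c; rewrite Sc -colE => /colP/(_ i).
by rewrite !mxE.
Qed.

End Lanczos.

(** * The Krylov Gram matrix in spectral coordinates *)

(** From [M L V = L V Lambda] follows [M^i R0 = L V Lambda^i gamma], and [L V] carries the Frobenius
    product to the [A^-1]-product because [L^T A^-1 L = I]. *)
Lemma gram_krylov_spectral (R : realType) (n m : nat) (A L V M : 'M[R]_n)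
  (lam : 'rV[R]_n) (R0 gamma : 'M[R]_(n, 3)) :
  A \in unitmx -> A = L *m L^T -> V^T *m V = 1%:M ->
  invmx L *m M *m L = V *m diag_mx lam *m V^T -> R0 = L *m V *m gamma ->
  let Vm : 'M[R]_(n, m) := \matrix_(i < n, j < m) lam 0 i ^+ j in
  gram (invmx A) (fun i : 'I_m => M ^+ i *m R0) =
  Vm^T *m diag_mx (\row_(i < n) \sum_(j < 3) `|gamma i j| ^+ 2) *m Vm.
Proof.
move=> Au AL VV LML R0E Vm.
have Lu : L \in unitmx by move: Au; rewrite AL unitmx_mul => /andP[].
have MLV : M *m (L *m V) = L *m V *m diag_mx lam.
  rewrite mulmxA -[M *m L](mulKVmx Lu) [invmx L *m _]mulmxA LML.
  by rewrite -!mulmxA VV mulmx1.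
pose g (i : nat) : 'M[R]_(n, 3) := \matrix_(l, q) (lam 0 l ^+ i * gamma l q).
have MR0 i : M ^+ i *m R0 = L *m V *m g i.
  elim: i => [|i IH].
    rewrite expr0 [LHS]mul1mx R0E; congr (_ *m _).
    by apply/matrixP => l q; rewrite mxE mul1r.
  rewrite mulmx_exprS IH mulmxA MLV -(mulmxA _ (diag_mx lam)); congr (_ *m _).
  by rewrite mul_diag_mx; apply/matrixP => l q; rewrite !mxE exprS mulrA.
have AiE (X Z : 'M[R]_(n, 3)) :
    innerM (invmx A) (L *m V *m X) (L *m V *m Z) = \tr (Z^T *m X).
  have AiL : invmx A *m L = invmx L^T.
    have Ltu : L^T \in unitmx by rewrite unitmx_tr.
    by rewrite -[L in LHS](mulmxK Ltu) -AL mulKmx.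
  rewrite /innerM !trmx_mul -!mulmxA (mulmxA (invmx A)) AiL.
  by rewrite mulKVmx ?unitmx_tr // (mulmxA V^T) VV mul1mx.
apply/matrixP => i j; rewrite mxE !MR0 AiE mul_mx_diag.
under [LHS]eq_bigr do rewrite mxE.
(* Summing over the three columns inside the sum over eigenvalues makes the weights of the diagonal
   matrix appear. *)
rewrite [LHS]exchange_big [RHS]mxE; apply: eq_bigr => l _.
rewrite !mxE mulr_sumr mulr_suml; apply: eq_bigr => q _.
rewrite !mxE real_normK ?num_real // expr2.
by rewrite mulrACA mulrAC mulrC (mulrC (_ ^+ j)) mulrAC mulrA.
Qed.

(** * Residual and error of the iterate *)

Section Iterate.

Variables (R : realType) (n k : nat) (A P : 'M[R]_n).
Variables (H Y0 Yk : 'M[R]_(n, 3)).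
Hypotheses (hA : spd A) (hP : spd P) (hYk : pgcg_iterate A P H Y0 k Yk).

Let B := invmx P.
Let M := A *m B.
Let R0 := H - M *m Y0.
Let Rk := H - M *m Yk.

(** In [R_k = R_0 - M (Y_k - Y_0)] the factor [M] raises every power by one, so only [R_0] itself
    contributes to power 0. *)
Lemma pgcg_residual_expansion :
  exists2 c : 'cV[R]_k.+1, c 0 0 = 1 &
    Rk = \sum_i c i 0 *: (M ^+ i *m R0).
Proof.
have /krylovP[psi YE] := proj1 hYk.
exists (\col_i if unlift ord0 i is Some j then - psi j else 1).
  by rewrite mxE unlift_none.
rewrite big_ord_recl mxE unlift_none scale1r expr0 [1 *m _]mul1mx.
have -> : Rk = R0 - M *m (Yk - Y0) by rewrite mulmxBr opprB addrA subrK.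
rewrite YE; congr (_ + _); rewrite mulmx_sumr -sumrN; apply: eq_bigr => i _.
by rewrite mxE liftK -scalemxAr scaleNr mulmx_exprS.
Qed.

Let W := gram (invmx A) (fun i : 'I_k.+1 => M ^+ i *m R0).

(** Entry [i] of [W c] is the [A^-1]-product of [R_k] with [M^i R_0]. It vanishes for [i >= 1];
    hence expanding the second [R_k] in its square norm leaves only the [R_0] term, with coefficient
    1, which is entry 0. *)
Lemma pgcg_residual_gram (c : 'cV[R]_k.+1) : c 0 0 = 1 ->
  Rk = \sum_i c i 0 *: (M ^+ i *m R0) ->
  W *m c = innerM (invmx A) Rk Rk *: delta_mx 0 0.
Proof.
move=> c0 RkE; have Au := spd_unitmx hA.
have Rk_orth (j : 'I_k) : innerM (invmx A) Rk (M ^+ j.+1 *m R0) = 0.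
  rewrite mulmx_exprS.
  rewrite innerM_sym ?(proj1 (spd_invmx hA)) // innerM_invmx //.
  rewrite innerM_sym ?(proj1 (spd_invmx hP)) //; apply: (proj2 hYk).
  exact: krylov_mem.
have WcE i : (W *m c) i 0 = innerM (invmx A) Rk (M ^+ i *m R0).
  rewrite [Rk]RkE innerM_suml mxE; apply: eq_bigr => j _.
  by rewrite mxE mulrC.
have -> : innerM (invmx A) Rk Rk = innerM (invmx A) Rk (M ^+ 0 *m R0).
  rewrite {2}RkE innerM_sumr big_ord_recl c0 mul1r big1 ?addr0 // => j _.
  by rewrite Rk_orth mulr0.
apply/colP => i; rewrite WcE !mxE.
case: (unliftP ord0 i) => [j ->|->]; first by rewrite Rk_orth mulr0.
by rewrite mulr1.
Qed.

Lemma pgcg_residual_mem : Rk \in krylov k.+1 M R0.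
Proof.
have [c _ ->] := pgcg_residual_expansion.
by apply: rpred_sum => i _; apply: rpredZ; apply: krylov_mem.
Qed.

Lemma pgcg_error_norm (Ystar : 'M[R]_(n, 3)) : M *m Ystar = H ->
  normM (B *m A *m B) (Ystar - Yk) ^+ 2 = innerM (invmx A) Rk Rk.
Proof.
move=> YH; have -> : Rk = M *m (Ystar - Yk) by rewrite mulmxBr YH.
rewrite innerM_invmx ?spd_unitmx // innerM_sym ?(proj1 (spd_invmx hP)) //.
(* As an [A]-form the value is visibly nonnegative, so squaring the root in [normM] recovers it. *)
have -> : innerM B (M *m (Ystar - Yk)) (Ystar - Yk) =
    innerM A (B *m (Ystar - Yk)) (B *m (Ystar - Yk)).
  by rewrite /innerM trmx_mul (proj1 (spd_invmx hP)) !mulmxA.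
rewrite -(sqr_sqrtr (spd_innerM_ge0 _ hA)); congr (Num.sqrt _ ^+ 2).
by rewrite /innerM trmx_mul (proj1 (spd_invmx hP)) !mulmxA.
Qed.

End Iterate.

(** * The error identity, the residual bound and the tridiagonal forms *)

Theorem theorem3p3 (R : realType) (n k : nat) (hk : (1 <= k)%N)
  (A P : 'M[R]_n) (hA : spd A) (hP : spd P)
  (H Y0 Ystar Yk : 'M[R]_(n, 3))
  (hYstar : A *m invmx P *m Ystar = H)
  (hYk : pgcg_iterate A P H Y0 k Yk)
  (L V : 'M[R]_n) (lam : 'rV[R]_n) (gamma : 'M[R]_(n, 3))
  (u : nat -> 'M[R]_(n, 3)) :
  let R0 := H - A *m invmx P *m Y0 in
  let Ek := Ystar - Yk in
  let Rk := A *m invmx P *m Ek in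
  let K := krylov_matrix k.+1 (A *m invmx P) R0 in
  let D := diag_mx (\row_(i < n) \sum_(j < 3) `|gamma i j| ^+ 2) in
  let Vk1 : 'M[R]_(n, k.+1) := \matrix_(i < n, j < k.+1) lam 0 i ^+ j in
  let e1 : 'cV[R]_(k.+1) := delta_mx 0 0 in
  let W := Vk1^T *m D *m Vk1 in
  let w := (e1^T *m invmx W *m e1) 0 0 in
  let Uk := lanczos_block u k in
  let Uk1 := lanczos_block u k.+1 in
  let T := diamond Uk (invmx P *m A *m invmx P *m Uk) in
  let S := diamond Uk1 (invmx A *m Uk1) in
  let That := invmx S in
  diamond K (invmx A *m K) \in unitmx ->
  cholesky A L ->
  V^T *m V = 1%:M ->
  invmx L *m (A *m invmx P) *m L = V *m diag_mx lam *m V^T ->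
  R0 = L *m V *m gamma ->
  lanczos_basis A P R0 k u ->
  [/\ (* the inverses and quotients below are well defined *)
      [/\ W \in unitmx, w != 0 & S \in unitmx],
      normM (invmx P *m A *m invmx P) Ek ^+ 2 = 1 / w,
      (forall thetat theta : R,
         max_eigenvalue That thetat -> min_eigenvalue T theta ->
         theta != 0 /\
         normM (invmx P) Rk ^+ 2 <= 1 / w * (thetat ^+ k.+1 / theta ^+ k)) &
      exists (alpha eta : nat -> R) (etahat : R),
        T = tridiag k alpha eta /\
        That = tridiag k.+1
                 (fun i => if i == k.+1 then etahat else alpha i) eta].
Proof.
move=> R0 Ek Rk K D Vk1 e1 W w Uk Uk1 T S That Kunit [_ _ AL] VV LML R0E hu.
have Au := spd_unitmx hA; have hB := spd_invmx hP.
have WE : gram (invmx A) (fun i : 'I_k.+1 => (A *m invmx P) ^+ i *m R0) = W.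
  exact: gram_krylov_spectral AL VV LML R0E.
have Wu : W \in unitmx.
  by rewrite -WE; move: Kunit; rewrite [diamond _ _]diamond_gram.
have RkE : Rk = H - A *m invmx P *m Yk by rewrite /Rk mulmxBr hYstar.
set rho := innerM (invmx A) Rk Rk.
have rho_w : rho * w = 1.
  have [c c0 Rkc] := pgcg_residual_expansion hYk.
  apply: (invmx_corner Wu _ c0).
  by rewrite -WE (pgcg_residual_gram hA hP hYk c0 Rkc) -RkE.
have w0 : w != 0.
  by apply: contraTneq (oner_neq0 R) => w0; rewrite -rho_w w0 mulr0 eqxx.
have rhoE : rho = 1 / w by rewrite -rho_w mulfK.
have SE : S = gram (invmx A) (fun i : 'I_k.+1 => u i).
  by rewrite /S [diamond _ _](diamond_gram _ (fun i : 'I_k.+1 => u i)).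
have hS : spd S by rewrite SE; apply: lanczos_S_spd hA hu.
have hThat : spd That := spd_invmx hS.
have ThatE i j : That i (lift ord_max j) =
    innerM (invmx P) (A *m invmx P *m u j) (u i).
  by rewrite /That SE (lanczos_That hA hu).
have TE : T = \matrix_(i, j) innerM (invmx P) (A *m invmx P *m u j) (u i).
  exact: lanczos_T.
split.
- by split=> //; apply: spd_unitmx.
- by rewrite -rhoE /rho RkE; apply: pgcg_error_norm.
- move=> thetat theta [_ That_le] [T_theta _].
  have [thetat0 S_ge] := spd_diag_ge ord_max hS That_le.
  (* The leading block of [That] is [T], so [theta] is a Rayleigh quotient of [That]: positive, and
     at most [thetat]. *)
  have [x x0 xThat] : exists2 x : 'cV[R]_k.+1, x != 0 &
      (x^T *m That *m x) 0 0 = theta * (x^T *m x) 0 0.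
    apply: eigenvalue_lift_max T_theta => i j.
    by rewrite ThatE TE mxE lift_max.
  have xx0 : 0 < (x^T *m x) 0 0.
    have : 0 <= (x^T *m x) 0 0.
      by rewrite mxE sumr_ge0 // => i _; rewrite mxE -expr2 sqr_ge0.
    rewrite le_eqVlt => /predU1P[xx|//].
    by have := proj2 hThat x x0; rewrite xThat -xx mulr0 ltxx.
  have theta0 : 0 < theta.
    by rewrite -(pmulr_lgt0 _ xx0) -xThat; apply: (proj2 hThat).
  have theta_le : theta <= thetat.
    rewrite -(ler_pM2r xx0) -xThat; apply: symmetric_rayleigh_le That_le _.
    exact: (proj1 hThat).
  split; first by rewrite gt_eqF.
  set r := innerM (invmx P) Rk (u k).
  have Rkr : Rk = r *: u k.
    have Rk_mem : Rk \in krylov k.+1 (A *m invmx P) R0.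
      by rewrite RkE; apply: pgcg_residual_mem.
    (* For [i < k] the block [u i] lies in the Krylov space of order [k], so only the last
       coefficient survives. *)
    rewrite [LHS](lanczos_expansion hu Rk_mem) big_ord_recr /=.
    rewrite big1 ?add0r // => i _.
    have ui : u i \in krylov k (A *m invmx P) R0.
      exact: krylov_sub (ltn_ord i) (lanczos_mem hu (leqW (ltn_ord i))).
    by rewrite RkE (proj2 hYk) ?scale0r.
  have rhor : rho = r ^+ 2 * S ord_max ord_max.
    by rewrite /rho Rkr innerM_scale SE mxE.
  have -> : normM (invmx P) Rk ^+ 2 = r ^+ 2.
    rewrite sqr_sqrtr; last exact: spd_innerM_ge0.
    rewrite -[\tr _]/(innerM _ _ _) Rkr innerM_scale.
    by rewrite [innerM _ _ _](lanczos_orthonormal hu) // eqxx mulr1.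
  rewrite -rhoE rhor -mulrA ler_peMr ?sqr_ge0 //.
  (* The factor regroups as [(thetat * S_kk) * (thetat / theta)^k], a product of two numbers that
     are at least 1. *)
  rewrite exprS -mulrA -expr_div_n mulrA [_ * thetat]mulrC.
  rewrite (le_trans S_ge) // ler_peMr ?(le_trans ler01) //.
  by rewrite exprn_ege1 // ler_pdivlMr // mul1r.
- pose t i j := innerM (invmx P) (A *m invmx P *m u j) (u i).
  have tC i j : t i j = t j i := lanczos_tC u hA hP i j.
  (* Below the diagonal the value is written [t j i], so that both off-diagonals read the same
     sequence [eta]. *)
  have tE i j : (i < k.+1)%N -> (j < k.+1)%N -> t i j =
      if i == j then t i i else if j == i.+1 then t i j
      else if i == j.+1 then t j i else 0.
    move=> ik jk; have t0 := lanczos_t0 hu.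
    have [->//|ij] := eqVneq i j; have [//|ij1] := eqVneq j i.+1.
    have [_|ij2] := eqVneq i j.+1; first exact: tC.
    case: (ltngtP i j) ij => // ij _; last first.
      by apply: t0; rewrite ltn_neqAle eq_sym ij2 ij.
    by rewrite tC; apply: t0; rewrite ltn_neqAle eq_sym ij1 ij.
  (* All columns but the last are known; symmetry of [That] gives the last one except its corner,
     which becomes [etahat]. *)
  have That_t (i j : 'I_k.+1) :
      (i, j) != (ord_max, ord_max) -> That i j = t i j.
    case: (unliftP ord_max j) => [j' ->|->]; first by rewrite ThatE lift_max.
    case: (unliftP ord_max i) => [i' ->|->]; last by rewrite eqxx.
    by rewrite -(proj1 hThat) mxE ThatE tC lift_max.
  (* The predecessors undo the indexing from 1 in [tridiag]: [eta j.+1] is [t j.-1 j]. *)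
  exists (fun i => t i.-1 i.-1), (fun j => t j.-2 j.-1), (That ord_max ord_max).
  split.
    apply/matrixP => i j; rewrite TE !mxE -/(t i j) tE ?leqW //= -val_eqE /=.
    by case: (eqVneq (i : nat) j) => // _;
       case: eqP => [->|_] //; case: eqP => [->|].
  apply/matrixP => i j; rewrite [RHS]mxE.
  have [[-> ->]|ij] := eqVneq (i, j) (ord_max, ord_max); first by rewrite !eqxx.
  rewrite That_t // tE //= eqSS -val_eqE /=.
  case: (eqVneq (i : nat) j) => [ij'|_].
    have [ik|//] := eqVneq (i : nat) k.
    by case/eqP: ij; congr (_, _); apply: val_inj; rewrite /= -?ij'.
  by case: eqP => [->|_] //; case: eqP => [->|].
Qed.
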